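(* Let $\alpha\in(0,1)\cup(1,\infty)$ and let $p_{X,Y}=p_Xp_{Y\mid X}$ be a joint distribution on finite alphabets $\mathcal X\times\mathcal Y$. Then $$I_\alpha^{\mathrm{LP}}(X;Y)=\begin{cases}\min_{\tilde q_{X,Y}}\min_{q_Y}F_\alpha^{\mathrm{LP}}(\tilde q_{X,Y},q_Y),&\alpha\in(0,1),\\[2pt]\max_{\tilde q_{X,Y}}\max_{r_{X\mid Y}}\tilde F_\alpha^{\mathrm{LP}}(\tilde q_{X,Y},r_{X\mid Y}),&\alpha\in(1,\infty),\end{cases}$$ where, writing $\tilde q_{X,Y}=\tilde q_X\tilde q_{Y\mid X}$, $$F_\alpha^{\mathrm{LP}}(\tilde q_{X,Y},q_Y):=\frac{\alpha}{1-\alpha}D(\tilde q_{X,Y}\|\tilde q_Xp_{Y\mid X})+D(\tilde q_X\tilde q_{Y\mid X}\|\tilde q_Xq_Y)+\frac{\alpha}{1-\alpha}D(\tilde q_X\|p_X),$$ $$\tilde F_\alpha^{\mathrm{LP}}(\tilde q_{X,Y},r_{X\mid Y}):=\frac{\alpha}{1-\alpha}D(\tilde q_{X,Y}\|\tilde q_Xp_{Y\mid X})+\mathbb E^{\tilde q_{X,Y}}\!\left[\log\frac{r_{X\mid Y}(X\mid Y)}{\tilde q_X(X)}\right]+\frac{\alpha}{1-\alpha}D(\tilde q_X\|p_X).$$ Moreover, for $\alpha\in(1,\infty)$, $$I_\alpha^{\mathrm{LP}}(X;Y)=\max_{r_{X\mid Y}}\frac{2\alpha-1}{\alpha-1}\log\sum_xp_X(x)^{\frac{\alpha}{2\alpha-1}}\Big(\sum_yp_{Y\mid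 X}(y\mid x)\,r_{X\mid Y}(x\mid y)^{1-\frac1\alpha}\Big)^{\frac{\alpha}{2\alpha-1}}.$$
   Context: All alphabets are finite and $\log$ is natural. $D(p\|q)$ is the Kullback–Leibler divergence. The Rényi divergence is $D_\alpha(p\|q):=\frac{1}{\alpha-1}\log\sum_zp(z)^\alpha q(z)^{1-\alpha}$, and the Lapidoth–Pfister mutual information of order $\alpha$ is $I_\alpha^{\mathrm{LP}}(X;Y):=\min_{q_X}\min_{q_Y}D_\alpha(p_Xp_{Y\mid X}\|q_Xq_Y)$ over distributions $q_X$ on $\mathcal X$ and $q_Y$ on $\mathcal Y$. Optimizations over $\tilde q_{X,Y}$ range over joint distributions on $\mathcal X\times\mathcal Y$ (with $X$-marginal $\tilde q_X$ and conditional $\tilde q_{Y\mid X}$), over $q_Y$ over distributions on $\mathcal Y$, and over $r_{X\mid Y}$ over all reverse channels (families $\{r_{X\mid Y}(\cdot\mid y)\}_{y}$ of distributions on $\mathcal X$). *)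

(* Defs.v *)
From HB Require Import structures.
From mathcomp Require Import all_boot all_order all_algebra.
From mathcomp Require Import all_classical all_reals.
From mathcomp Require Import ereal exp.

Set Implicit Arguments. Unset Strict Implicit. Unset Printing Implicit Defensive.
Import Order.TTheory GRing.Theory Num.Theory.
Local Open Scope ring_scope.

Section Defs.
Variable R : realType.

Definition is_dist (T : finType) (p : T -> R) : Prop :=
  (forall t, 0 <= p t) /\ \sum_(t : T) p t = 1.

Definition margX (X Y : finType) (q : X * Y -> R) (x : X) : R :=
  \sum_(y : Y) q (x, y).

Definition KL (T : finType) (p q : T -> R) : \bar R :=
  if `[< exists t, 0 < p t /\ q t = 0 >] then +oo%E
  else (\sum_(t : T) (if 0 < p t then p t * ln (p t / q t) else 0))%:E.

(* Renyi divergence of order a (a > 0, a <> 1), with the usual conventions: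
   for a < 1 it is +oo iff sum_z p^a q^(1-a) = 0 (disjoint supports);
   for a > 1 it is +oo iff p is not << q, and terms with q z = 0 (hence
   p z = 0) contribute 0. *)
Definition renyi (T : finType) (a : R) (p q : T -> R) : \bar R :=
  let s := \sum_(t : T) (if 0 < p t then p t `^ a * q t `^ (1 - a) else 0) in
  if a < 1 then
    (if s == 0 then +oo%E else ((a - 1)^-1 * ln s)%:E)
  else
    (if `[< exists t, 0 < p t /\ q t = 0 >] then +oo%E
     else ((a - 1)^-1 * ln s)%:E).

(* Lapidoth--Pfister alpha-mutual information of p_{X,Y} = p_X p_{Y|X}:
   min over q_X, q_Y of D_a(p_X p_{Y|X} || q_X q_Y) (taken as an infimum) *)
Definition ILP (X Y : finType) (a : R) (pX : X -> R) (pYX : X -> Y -> R)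
  : \bar R :=
  ereal_inf [set d | exists (qX : X -> R) (qY : Y -> R),
    [/\ is_dist qX, is_dist qY &
        d = renyi a (fun xy : X * Y => pX xy.1 * pYX xy.1 xy.2)
                    (fun xy : X * Y => qX xy.1 * qY xy.2)]].

(* F_a^LP(tq, qY) ; note tq_X tq_{Y|X} = tq *)
Definition F_LP (X Y : finType) (a : R) (pX : X -> R) (pYX : X -> Y -> R)
  (tq : X * Y -> R) (qY : Y -> R) : \bar R :=
  ((a / (1 - a))%:E *
     KL tq (fun xy : X * Y => (margX tq xy.1 * pYX xy.1 xy.2)%R)
   + KL tq (fun xy : X * Y => (margX tq xy.1 * qY xy.2)%R)
   + (a / (1 - a))%:E * KL (margX tq) pX)%E.

(* E^{tq}[ log r(X|Y) / tq_X(X) ], = -oo if r(x|y) = 0 for some (x,y) with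
   tq(x,y) > 0 ; here r y x stands for r_{X|Y}(x|y). *)
Definition Elog (X Y : finType) (tq : X * Y -> R) (r : Y -> X -> R) : \bar R :=
  if `[< exists xy : X * Y, 0 < tq xy /\ r xy.2 xy.1 = 0 >] then -oo%E
  else (\sum_(xy : X * Y)
          (if 0 < tq xy then tq xy * ln (r xy.2 xy.1 / margX tq xy.1)
           else 0))%:E.

Definition Ft_LP (X Y : finType) (a : R) (pX : X -> R) (pYX : X -> Y -> R)
  (tq : X * Y -> R) (r : Y -> X -> R) : \bar R :=
  ((a / (1 - a))%:E *
     KL tq (fun xy : X * Y => (margX tq xy.1 * pYX xy.1 xy.2)%R)
   + Elog tq r
   + (a / (1 - a))%:E * KL (margX tq) pX)%E.

Definition G_LP (X Y : finType) (a : R) (pX : X -> R) (pYX : X -> Y -> R)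
  (r : Y -> X -> R) : \bar R :=
  let b := a / (2 * a - 1) in
  let s := \sum_(x : X) pX x `^ b *
             (\sum_(y : Y) pYX x y * r y x `^ (1 - a^-1)) `^ b in
  if s == 0 then -oo%E else (((2 * a - 1) / (a - 1)) * ln s)%:E.

Definition is_min (A : Type) (P : A -> Prop) (f : A -> \bar R) (v : \bar R)
  : Prop := (exists2 x, P x & f x = v) /\ (forall x, P x -> (v <= f x)%E).
Definition is_max (A : Type) (P : A -> Prop) (f : A -> \bar R) (v : \bar R)
  : Prop := (exists2 x, P x & f x = v) /\ (forall x, P x -> (f x <= v)%E).

End Defs.

(* Main.v *)
(* Write A = a/(1-a) and p = p_X p_{Y|X}.  By the chain rule the two objectives are
   A D(tq||p) + D(tq || tq_X q_Y) and A D(tq||p) + E[log(r/tq_X)], while for any q,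
     A D(tq||p) + D(tq||q) = (a-1)^-1 sum tq log(p^a q^(1-a) / tq),
   so Gibbs' inequality bounds it by D_a(p||q), from below for a < 1 and from above
   for a > 1, with equality at the escort distribution tq ~ p^a q^(1-a).  Together
   with D(tq||tq_X q_Y) <= D(tq||q_X q_Y) this settles a < 1.  For a > 1, since
   E[log(r/tq_X)] <= D(tq||q_X q_Y), weak duality gives Ft <= I_a; equality holds
   because stationarity of a minimizing pair (q_X, q_Y) says exactly that q_X and
   q_Y are the marginals of the escort distribution, so r = tq/q_Y closes the gap.
   Finally, maximizing Ft over tq at fixed r has an explicit solution, with value G(r). *)

Require Import Defs.
From HB Require Import structures.
From mathcomp Require Import all_boot all_order all_algebra.
From mathcomp Require Import all_classical all_reals.
From mathcomp Require Import ereal exp.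
From mathcomp Require Import topology normedtype derive ring lra.
Import Order.TTheory GRing.Theory Num.Theory.
Import numFieldNormedType.Exports.
Local Open Scope ring_scope.

(** * Finite distributions, Gibbs' inequality and the chain rule for [KL] *)

Section Dist.
Set Implicit Arguments.
Unset Strict Implicit.
Context {R : realType}.
Implicit Type T X Y : finType.

Lemma ln_le_subr1 (x : R) : 0 < x -> ln x <= x - 1.
Proof. by move=> x0; rewrite -{1}(subrKC 1 x) le_ln1Dx //; lra. Qed.

Lemma dist_sum_supp {T} (t : T -> R) : is_dist t -> \sum_(i | 0 < t i) t i = 1.
Proof.
move=> [t0 <-]; rewrite [RHS](bigID (fun i => 0 < t i)) /= [X in _ = _ + X]big1 ?addr0//.
by move=> i; rewrite lt_neqAle t0 andbT negbK => /eqP.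
Qed.

Lemma dist_mean_const {T} (t : T -> R) (c : R) :
  is_dist t -> \sum_(i | 0 < t i) t i * c = c.
Proof. by move=> /dist_sum_supp t1; rewrite -mulr_suml t1 mul1r. Qed.

Lemma dist_supp {T} (t : T -> R) : is_dist t -> exists i, 0 < t i.
Proof.
move=> td; apply: contrapT => /forallNP tN.
have /esym/eqP := dist_sum_supp td; rewrite big_pred0 ?oner_eq0// => i.
exact/negP/tN.
Qed.

Lemma dist_le1 {T} (t : T -> R) i : is_dist t -> t i <= 1.
Proof. by move=> [t0 <-]; rewrite (bigD1 i)//= lerDl sumr_ge0. Qed.

Lemma dist_eq0 {T} (t : T -> R) i : is_dist t -> ~~ (0 < t i) -> t i = 0.
Proof. by move=> [t0 _]; rewrite lt_neqAle t0 andbT negbK => /eqP. Qed.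

Lemma sum_supp_le {T} (t w : T -> R) : (forall i, 0 <= w i) ->
  \sum_(i | 0 < t i) w i <= \sum_i w i.
Proof.
by move=> w0; rewrite [leRHS](bigID (fun i => 0 < t i)) /= lerDl sumr_ge0.
Qed.

Lemma sum_gt0 {T} (w : T -> R) i : (forall i, 0 <= w i) -> 0 < w i -> 0 < \sum_i w i.
Proof. by move=> w0 wi; rewrite (bigD1 i)//= ltr_pwDl// sumr_ge0. Qed.

(** Termwise [ln u <= u - 1] at [u = w i / (t i * W)]. The weights [w] need not be normalised, so
    the bound applies directly to Hellinger sums. *)
Lemma gibbs {T} (t w : T -> R) : is_dist t -> (forall i, 0 <= w i) ->
  (forall i, 0 < t i -> 0 < w i) ->
  \sum_(i | 0 < t i) t i * (ln (w i) - ln (t i)) <= ln (\sum_i w i).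
Proof.
move=> td w0 tw; set W := \sum_i w i.
have W0 : 0 < W by have [i /tw] := dist_supp td; exact: sum_gt0.
rewrite -subr_le0 -[X in _ - X](dist_mean_const (ln W) td) -sumrB.
apply: (@le_trans _ _ (\sum_(i | 0 < t i) (w i / W - t i))).
  apply: ler_sum => i ti; have wi := tw i ti.
  have -> : w i / W - t i = t i * (w i / (t i * W) - 1) by field; rewrite !gt_eqF.
  rewrite -mulrBr ler_pM2l// (le_trans _ (ln_le_subr1 _))// ?divr_gt0 ?mulr_gt0//.
  by rewrite ln_div ?lnM ?posrE ?mulr_gt0//; lra.
rewrite sumrB -mulr_suml (dist_sum_supp td) subr_le0 ler_pdivrMr// mul1r.
exact: sum_supp_le.
Qed.

Lemma margX_ge {X Y} (q : X * Y -> R) (xy : X * Y) : is_dist q -> q xy <= margX q xy.1.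
Proof.
by case: xy => x y [q0 _]; rewrite /margX (bigD1 y)//= lerDl sumr_ge0.
Qed.

Lemma margX_gt0 {X Y} (q : X * Y -> R) (xy : X * Y) :
  is_dist q -> 0 < q xy -> 0 < margX q xy.1.
Proof. by move=> qd q0; apply: lt_le_trans q0 (margX_ge _ qd). Qed.

Lemma margX_gt0_ex {X Y} (q : X * Y -> R) x : is_dist q -> 0 < margX q x ->
  exists y, 0 < q (x, y).
Proof.
move=> qd; rewrite /margX lt_neqAle => /andP[/eqP m0 _].
apply: contra_notP m0 => /forallNP qN; rewrite big1// => y _.
by apply: dist_eq0 => //; exact/negP.
Qed.

Lemma margX_dist {X Y} (q : X * Y -> R) : is_dist q -> is_dist (margX q).
Proof.
move=> [q0 q1]; split; first by move=> x; apply: sumr_ge0.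
by rewrite -q1 pair_big; apply: eq_bigr => -[].
Qed.

Lemma prod_dist {X Y} (p : X -> R) (q : X -> Y -> R) :
  is_dist p -> (forall x, is_dist (q x)) ->
  is_dist (fun xy : X * Y => p xy.1 * q xy.1 xy.2).
Proof.
move=> [p0 p1] qd; split; first by move=> xy; rewrite mulr_ge0 ?p0 ?(qd _).1.
rewrite -(pair_big xpredT xpredT (fun x y => p x * q x y))/=.
by rewrite -p1; apply: eq_bigr => x _; rewrite -mulr_sumr (qd x).2 mulr1.
Qed.

Lemma sum_margX {X Y} (q : X * Y -> R) (f : X -> R) : is_dist q ->
  \sum_(xy | 0 < q xy) q xy * f xy.1 = \sum_(x | 0 < margX q x) margX q x * f x.
Proof.
move=> qd; rewrite [LHS]big_mkcond [RHS]big_mkcond/=.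
rewrite (eq_bigr (fun xy => q (xy.1, xy.2) * f xy.1)); last first.
  by move=> [x y] _ /=; case: ifPn => // /dist_eq0 ->; rewrite ?mul0r.
rewrite -(pair_big xpredT xpredT (fun x y => q (x, y) * f x))/=.
apply: eq_bigr => x _; rewrite -mulr_suml; case: ifPn => // /dist_eq0 m0.
by rewrite -/(margX q x) m0 ?mul0r//; exact: margX_dist.
Qed.

(** The left side is [- D(q_X || p)], kept as a sum over the joint support so that it combines with
    other joint sums term by term. *)
Lemma gibbs_margX {X Y} (q : X * Y -> R) (p : X -> R) : is_dist q -> is_dist p ->
  (forall xy, 0 < q xy -> 0 < p xy.1) ->
  \sum_(xy | 0 < q xy) q xy * (ln (p xy.1) - ln (margX q xy.1)) <= 0.
Proof.
move=> qd pd qp; rewrite (sum_margX (fun x => ln (p x) - ln (margX q x)))//.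
rewrite -[leRHS](@ln1 R) -pd.2; apply: gibbs; [exact: margX_dist|exact: pd.1|].
by move=> x /(margX_gt0_ex qd)[y /qp].
Qed.

Lemma KL_fin {T} (p q : T -> R) : (forall t, 0 < p t -> 0 < q t) ->
  KL p q = (\sum_(t | 0 < p t) p t * (ln (p t) - ln (q t)))%:E.
Proof.
move=> pq; rewrite /KL asboolF; last first.
  by move=> [t [/pq + q0]]; rewrite q0 ltxx.
by rewrite -big_mkcond; congr EFin; apply: eq_bigr => t pt; rewrite ln_div ?posrE ?pq.
Qed.

Lemma KL_infty {T} (p q : T -> R) t : 0 < p t -> q t = 0 -> KL p q = +oo%E.
Proof. by move=> pt qt; rewrite /KL asboolT//; exists t. Qed.

Lemma KL_ninfty {T} (p q : T -> R) : KL p q != -oo%E.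
Proof. by rewrite /KL; case: ifP. Qed.

Lemma KL_cases {T} (p q : T -> R) : (forall t, 0 <= q t) ->
  (forall t, 0 < p t -> 0 < q t) \/ (exists t, 0 < p t /\ q t = 0).
Proof.
move=> q0; have [|pq] := pselect (exists t, 0 < p t /\ q t = 0); first by right.
left=> t pt; rewrite lt_neqAle q0 andbT; apply/eqP => qt; apply: pq; by exists t.
Qed.

(** On finite values the logarithms split. Otherwise both sides are [+oo]: a point of infinite
    marginal divergence lifts to some [(x, y)] with [0 < tq (x, y)]. *)
Lemma KL_chain {X Y} (tq : X * Y -> R) (p : X -> R) (q : X -> Y -> R) :
  is_dist tq -> (forall x, 0 <= p x) -> (forall x y, 0 <= q x y) ->
  (KL tq (fun xy => (margX tq xy.1 * q xy.1 xy.2)%R) + KL (margX tq) p =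
   KL tq (fun xy => (p xy.1 * q xy.1 xy.2)%R))%E.
Proof.
move=> td p0 q0; have md := margX_dist td.
have mq0 (xy : X * Y) : 0 <= margX tq xy.1 * q xy.1 xy.2 by rewrite mulr_ge0// md.1.
have [tq_q|[xy [txy qxy]]] := KL_cases tq mq0.
- have {}tq_q xy : 0 < tq xy -> 0 < q xy.1 xy.2.
    by move=> t0; have := tq_q _ t0; rewrite pmulr_rgt0// margX_gt0.
  have [tp|[x [mx px]]] := KL_cases (margX tq) p0; last first.
    have [y txy] := margX_gt0_ex td mx.
    rewrite (KL_infty mx px) addey ?KL_ninfty//.
    by apply/esym/(KL_infty txy); rewrite /= px mul0r.
  have mg xy : 0 < tq xy -> 0 < margX tq xy.1 by exact: margX_gt0.
  rewrite !KL_fin//; [|by move=> xy t0; rewrite mulr_gt0 ?tq_q ?tp ?mg..].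
  rewrite -EFinD -(sum_margX (fun x => ln (margX tq x) - ln (p x)))// -big_split/=.
  congr EFin; apply: eq_bigr => xy t0; have m0 := mg _ t0.
  by rewrite !lnM ?posrE ?tq_q ?tp//; ring.
- have q00 : q xy.1 xy.2 = 0.
    by move/eqP: qxy; rewrite mulf_eq0 gt_eqF ?margX_gt0// => /eqP.
  rewrite (KL_infty txy) ?q00 ?mulr0// addye ?KL_ninfty//.
  by apply/esym/(KL_infty txy); rewrite q00 mulr0.
Qed.

End Dist.

(** * Variational bounds on the Rényi divergence *)

Section Variational.
Set Implicit Arguments.
Unset Strict Implicit.
Context {R : realType}.
Implicit Type T X Y : finType.

(** Literally the summand of [renyi], guard included, so that the sum there folds to this name. *)
Definition hellinger {T} (a : R) (p q : T -> R) (t : T) : R :=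
  if 0 < p t then p t `^ a * q t `^ (1 - a) else 0.

Lemma hellinger_ge0 {T} (a : R) (p q : T -> R) t : 0 <= hellinger a p q t.
Proof. by rewrite /hellinger; case: ifPn => // _; rewrite mulr_ge0 ?powR_ge0. Qed.

Lemma hellinger_gt0 {T} (a : R) (p q : T -> R) t :
  0 < p t -> 0 < q t -> 0 < hellinger a p q t.
Proof. by move=> p0 q0; rewrite /hellinger p0 mulr_gt0 ?powR_gt0. Qed.

Lemma ln_hellinger {T} (a : R) (p q : T -> R) t : 0 < p t -> 0 < q t ->
  ln (hellinger a p q t) = a * ln (p t) + (1 - a) * ln (q t).
Proof. by move=> p0 q0; rewrite /hellinger p0 lnM ?posrE ?powR_gt0// !ln_powR. Qed.

Lemma renyi_fin {T} (a : R) (p q : T -> R) :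
  (a < 1 -> \sum_t hellinger a p q t != 0) ->
  (1 <= a -> forall t, 0 < p t -> 0 < q t) ->
  renyi a p q = ((a - 1)^-1 * ln (\sum_t hellinger a p q t))%:E.
Proof.
rewrite /renyi -/(hellinger a p q); have [a1 /(_ isT)/negPf|a1 _ /(_ isT) pq] := ltP a 1.
  by move=> h0 _; rewrite [X in if X then _ else _]h0.
by rewrite asboolF// => -[t [/pq + qt]]; rewrite qt ltxx.
Qed.

Section FixedOrder.
Context {T : finType} (a : R) (p q t : T -> R).
Hypotheses (a1 : a != 1) (td : is_dist t).
Hypotheses (p0 : forall i, 0 <= p i) (q0 : forall i, 0 <= q i).

(** Since [a / (1 - a) + 1 = (1 - a)^-1], the two [ln (t i)] terms merge with the coefficient that
    Gibbs' inequality needs. *)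
Lemma KL_hellinger :
  (forall i, 0 < t i -> 0 < p i) -> (forall i, 0 < t i -> 0 < q i) ->
  ((a / (1 - a))%:E * KL t p + KL t q =
   ((a - 1)^-1 * \sum_(i | 0 < t i) t i * (ln (hellinger a p q i) - ln (t i)))%:E)%E.
Proof.
move=> tp tq; rewrite !KL_fin// -EFinM -EFinD !mulr_sumr -big_split/=; congr EFin.
apply: eq_bigr => i ti; rewrite ln_hellinger ?tp ?tq//.
by field; apply/andP; split; rewrite subr_eq0// eq_sym.
Qed.

Lemma gibbs_hellinger :
  (forall i, 0 < t i -> 0 < p i) -> (forall i, 0 < t i -> 0 < q i) ->
  \sum_(i | 0 < t i) t i * (ln (hellinger a p q i) - ln (t i)) <=
  ln (\sum_i hellinger a p q i).
Proof.
move=> tp tq; apply: gibbs => // i; first exact: hellinger_ge0.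
by move=> ti; rewrite hellinger_gt0 ?tp ?tq.
Qed.

(** [(a - 1)^-1] is negative and flips Gibbs' inequality. An infinite divergence makes the right
    side [+oo], as [a / (1 - a)] is positive. *)
Lemma renyi_le : 0 < a < 1 ->
  (renyi a p q <= (a / (1 - a))%:E * KL t p + KL t q)%E.
Proof.
move=> /andP[a0 a_lt1].
have A0 : (0 < a / (1 - a))%R by rewrite divr_gt0// subr_gt0.
have [tp|[i [ti qi]]] := KL_cases t p0; last first.
  by rewrite (KL_infty ti qi) gt0_muley ?lte_fin// addye ?leey ?KL_ninfty.
have [tq|[i [ti qi]]] := KL_cases t q0; last first.
  by rewrite (KL_infty ti qi) addey ?leey// KL_fin.
rewrite KL_hellinger// renyi_fin; first last.
- by rewrite leNgt a_lt1.
- move=> _; have [i ti] := dist_supp td; rewrite gt_eqF//.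
  by apply: (@sum_gt0 _ _ _ i) => [j|]; rewrite ?hellinger_ge0// hellinger_gt0 ?tp ?tq.
by rewrite lee_fin ler_nM2l ?gibbs_hellinger// invr_lt0 subr_lt0.
Qed.

(** [(a - 1)^-1] is now positive and preserves Gibbs' inequality. *)
Lemma renyi_ge : 1 < a ->
  ((a / (1 - a))%:E * KL t p + KL t q <= renyi a p q)%E.
Proof.
move=> a_gt1.
have A0 : (a / (1 - a) < 0)%R by rewrite pmulr_rlt0 ?invr_lt0 ?subr_lt0//; lra.
(* If [t] charges a zero of [p], the first term is [-oo] and absorbs the second one, even [+oo]. If
   [p] charges a zero of [q], the right side is [+oo]. *)
have [tp|[i [ti pi]]] := KL_cases t p0; last first.
  by rewrite (KL_infty ti pi) lt0_muley ?lte_fin// addNye leNye.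
have [pq|[i [ti qi]]] := KL_cases p q0; last first.
  rewrite /renyi ltNge (ltW a_gt1) asboolT ?leey//; by exists i.
have tq i : 0 < t i -> 0 < q i by move=> /tp/pq.
rewrite KL_hellinger// renyi_fin//; last by rewrite ltNge (ltW a_gt1).
by rewrite lee_fin ler_pM2l ?gibbs_hellinger// invr_gt0 subr_gt0.
Qed.

End FixedOrder.

Definition escort {T} (a : R) (p q : T -> R) (t : T) : R :=
  hellinger a p q t / \sum_i hellinger a p q i.

Lemma escort_dist {T} (a : R) (p q : T -> R) :
  0 < \sum_i hellinger a p q i -> is_dist (escort a p q).
Proof.
move=> S0; split; first by move=> t; rewrite divr_ge0 ?hellinger_ge0// ltW.
by rewrite -mulr_suml divff// gt_eqF.
Qed.

Lemma escort_supp {T} (a : R) (p q : T -> R) t : a != 1 -> (forall i, 0 <= q i) ->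
  0 < escort a p q t -> 0 < p t /\ 0 < q t.
Proof.
move=> a1 q0; rewrite /escort /hellinger; case: ifPn => [pt|_]; last by rewrite mul0r ltxx.
split => //; rewrite lt_neqAle q0 andbT eq_sym; apply: contraTN H => /eqP ->.
(* A power of 0 with nonzero exponent is 0, also for the negative exponent [1 - a] of the case
   [1 < a]. *)
by rewrite powR0 ?mulr0 ?mul0r ?ltxx// subr_eq0 eq_sym.
Qed.

(** Equality case of Gibbs: on the support, [ln (hellinger a p q i) - ln (escort a p q i)] is the
    constant log of the Hellinger sum. *)
Lemma escort_KL {T} (a : R) (p q : T -> R) : a != 1 -> (forall i, 0 <= q i) ->
  0 < \sum_i hellinger a p q i ->
  ((a / (1 - a))%:E * KL (escort a p q) p + KL (escort a p q) q =
   ((a - 1)^-1 * ln (\sum_t hellinger a p q t))%:E)%E.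
Proof.
move=> a1 q0 S0; have ed := escort_dist S0.
have es i : 0 < escort a p q i -> 0 < p i /\ 0 < q i by exact: escort_supp.
rewrite KL_hellinger//; [|by move=> i /es[]..].
rewrite -(dist_mean_const (ln (\sum_t hellinger a p q t)) ed); congr (_ * _)%:E.
apply: eq_bigr => i ei; have [pi qi] := es _ ei; have hi := hellinger_gt0 a pi qi.
by rewrite /escort ln_div ?posrE//; ring.
Qed.

(** When the right side is finite, the gap is [D(tq_X || qX)]. *)
Lemma KL_margX_le {X Y} (tq : X * Y -> R) (qX : X -> R) (qY : Y -> R) :
  is_dist tq -> is_dist qX -> (forall y, 0 <= qY y) ->
  (KL tq (fun xy => (margX tq xy.1 * qY xy.2)%R) <=
   KL tq (fun xy => (qX xy.1 * qY xy.2)%R))%E.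
Proof.
move=> td qXd qY0.
have q0 (xy : X * Y) : 0 <= qX xy.1 * qY xy.2 by rewrite mulr_ge0 ?qXd.1.
have [tqq|[xy [txy qxy]]] := KL_cases tq q0; last by rewrite (KL_infty txy qxy) leey.
have tX xy : 0 < tq xy -> 0 < qX xy.1.
  move=> /tqq; rewrite lt_neqAle => /andP[/eqP + _]; rewrite lt_neqAle qXd.1 andbT.
  by move=> qq; apply/eqP => q; apply: qq; rewrite -q mul0r.
have tY xy : 0 < tq xy -> 0 < qY xy.2.
  by move=> t0; have := tqq _ t0; rewrite pmulr_rgt0// tX.
have tm xy : 0 < tq xy -> 0 < margX tq xy.1 by exact: margX_gt0.
rewrite !KL_fin//; last by move=> xy t0; rewrite mulr_gt0 ?tm ?tY.
rewrite lee_fin -subr_le0 -sumrB; apply: le_trans (gibbs_margX td qXd tX).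
rewrite le_eqVlt; apply/orP; left; apply/eqP; apply: eq_bigr => xy t0.
by rewrite !lnM ?posrE ?tm ?tX ?tY//; ring.
Qed.

Lemma Elog_fin {X Y} (tq : X * Y -> R) (r : Y -> X -> R) :
  is_dist tq -> (forall xy, 0 < tq xy -> 0 < r xy.2 xy.1) ->
  Elog tq r =
  (\sum_(xy | 0 < tq xy) tq xy * (ln (r xy.2 xy.1) - ln (margX tq xy.1)))%:E.
Proof.
move=> td tr; rewrite /Elog asboolF; last by move=> [t [/tr + q0]]; rewrite q0 ltxx.
rewrite -big_mkcond; congr EFin; apply: eq_bigr => xy t0.
by rewrite ln_div ?posrE ?tr// margX_gt0.
Qed.

Lemma Elog_cases {X Y} (tq : X * Y -> R) (r : Y -> X -> R) :
  (forall y x, 0 <= r y x) ->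
  (forall xy, 0 < tq xy -> 0 < r xy.2 xy.1) \/ Elog tq r = -oo%E.
Proof.
move=> r0.
have [|txy] := KL_cases tq (q := fun xy => r xy.2 xy.1) (fun xy => r0 xy.2 xy.1).
  by left.
by right; rewrite /Elog asboolT.
Qed.

(** When both sides are finite, the gap is the divergence of [tq] from the joint distribution
    [qY y * r y x]. *)
Lemma Elog_le {X Y} (tq : X * Y -> R) (qY : Y -> R) (r : Y -> X -> R) :
  is_dist tq -> is_dist qY -> (forall y, is_dist (r y)) ->
  (Elog tq r <= KL tq (fun xy => (margX tq xy.1 * qY xy.2)%R))%E.
Proof.
move=> td qYd rd; have r0 y x : 0 <= r y x by exact: (rd y).1.
have [tr|->] := Elog_cases tq r0; last by rewrite leNye.
have mq0 (xy : X * Y) : 0 <= margX tq xy.1 * qY xy.2.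
  by rewrite mulr_ge0 ?qYd.1// (margX_dist td).1.
have [tmq|[xy [txy qxy]]] := KL_cases tq mq0; last by rewrite (KL_infty txy qxy) leey.
have tm xy : 0 < tq xy -> 0 < margX tq xy.1 by exact: margX_gt0.
have tY xy : 0 < tq xy -> 0 < qY xy.2.
  by move=> t0; have := tmq _ t0; rewrite pmulr_rgt0// tm.
rewrite Elog_fin// KL_fin// lee_fin -subr_le0 -sumrB.
have qr1 : \sum_(xy : X * Y) qY xy.2 * r xy.2 xy.1 = 1.
  rewrite -(pair_big xpredT xpredT (fun x y => qY y * r y x))/= exchange_big/=.
  by rewrite -qYd.2; apply: eq_bigr => y _; rewrite -mulr_sumr (rd y).2 mulr1.
have := @gibbs _ _ tq (fun xy => qY xy.2 * r xy.2 xy.1) td.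
rewrite qr1 ln1 => g; apply: le_trans (g _ _).
- rewrite le_eqVlt; apply/orP; left; apply/eqP; apply: eq_bigr => xy t0.
  by rewrite !lnM ?posrE ?tm ?tr ?tY//; ring.
- by move=> xy; rewrite mulr_ge0 ?qYd.1.
- by move=> xy t0; rewrite mulr_gt0 ?tY ?tr.
Qed.

End Variational.

(** * Compactness and existence of minimizing pairs of distributions *)

Section Existence.
Local Open Scope classical_set_scope.
Set Implicit Arguments.
Unset Strict Implicit.
Context {R : realType}.
Implicit Type T X Y : finType.

Lemma continuous_powR_gt0 (e x : R) : 0 < x -> {for x, continuous (@powR R ^~ e)}.
Proof.
move=> x0; apply: differentiable_continuous; apply/derivable1_diffP.
by apply: derivable_powR; rewrite in_itv/= x0.
Qed.

(** The absolute value yields continuity on all of [R]; [powR] alone does not tend to 0 from the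
    left of 0. *)
Lemma continuous_powR_norm (e : R) : 0 < e -> continuous (fun u : R => `|u| `^ e).
Proof.
move=> e0 x; have [->|x0] := eqVneq x 0; last first.
  apply: (@continuous_comp _ _ _ (fun u : R => `|u|) (@powR R ^~ e)).
    exact: norm_continuous.
  by apply: continuous_powR_gt0; rewrite normr_gt0.
apply/cvgrPdist_lt => /= eps eps0; near=> u.
rewrite normr0 powR0 ?gt_eqF// sub0r normrN ger0_norm ?powR_ge0//.
(* By monotonicity of the power, the radius around 0 is [eps] to the power [e^-1]. *)
have -> : eps = (eps `^ e^-1) `^ e by rewrite -powRrM mulVf ?gt_eqF// powRr1// ltW.
rewrite gt0_ltr_powR ?nnegrE ?powR_ge0//.
near: u; apply: (@nbhs0_lt _ R^o); exact: powR_gt0.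
Unshelve. all: by end_near. Qed.

Lemma continuous_powR_max (d e : R) : 0 < d -> continuous (fun u : R => Num.max u d `^ e).
Proof.
move=> d0 x; apply: (@continuous_comp _ _ _ (fun u : R => Num.max u d) (@powR R ^~ e)).
  apply: (@continuous_max R R id (cst d)); [exact: cvg_id|exact: cvg_cst].
by apply: continuous_powR_gt0; rewrite lt_max d0 orbT.
Qed.

(** Extreme value theorem on pairs of distributions. The summands [phi] are left abstract so that
    [a < 1] and [1 < a] can each supply a continuous version of theirs. *)
Lemma exists_min_dist_prod {X Y} (phi : X -> Y -> R -> R) (qX0 : X -> R) (qY0 : Y -> R) :
  (forall x y, continuous (phi x y)) -> is_dist qX0 -> is_dist qY0 ->
  exists qX qY, [/\ is_dist qX, is_dist qY &
    forall qX' qY', is_dist qX' -> is_dist qY' ->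
      \sum_xy phi xy.1 xy.2 (qX xy.1 * qY xy.2) <=
      \sum_xy phi xy.1 xy.2 (qX' xy.1 * qY' xy.2)].
Proof.
move=> cphi qX0d qY0d.
(* A pair of distributions becomes one point indexed by [X + Y], in a cube that is compact by
   Tychonoff; the two normalisations cut out a closed subset. *)
pose E : topologicalType := prod_topology (fun _ : (X + Y)%type => R : topologicalType).
have ev_cont (i : X + Y) : continuous (fun f : E => f i).
  exact: (@proj_continuous _ (fun _ : (X + Y)%type => R : topologicalType) i).
have sum_cont (J : finType) (F : J -> E -> R) :
    (forall j, continuous (F j)) -> continuous (fun f => \sum_j F j f).
  move=> cF; apply: (@continuous_big R J +%R 0 xpredT _ E) => [|j _]; last exact: cF.
  by move=> z; apply: cvgD; [exact: cvg_fst|exact: cvg_snd].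
pose B : set E := [set f | forall i, `[0, 1]%classic (f i)].
have cB : compact B.
  apply: (@tychonoff _ (fun _ : (X + Y)%type => R : topologicalType)
    (fun _ => `[0, 1]%classic)) => i.
  exact: segment_compact.
pose K := B `&` (fun f : E => \sum_x f (inl x)) @^-1` [set 1]
            `&` (fun f : E => \sum_y f (inr y)) @^-1` [set 1].
have cK : compact K.
  by apply: compact_closedI; [apply: compact_closedI => //|];
    apply: closed_comp => [f _|]; try exact: closed_eq; exact: sum_cont.
pose join (qX : X -> R) (qY : Y -> R) : E :=
  fun i => match i with inl x => qX x | inr y => qY y end.
have joinK qX qY : is_dist qX -> is_dist qY -> K (join qX qY).
  move=> qXd qYd; split; [split|]; [|exact: qXd.2|exact: qYd.2].
  by move=> [x|y]; rewrite /= in_itv/= dist_le1// ?qXd.1 ?qYd.1.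
pose G (f : E) := \sum_xy phi xy.1 xy.2 (f (inl xy.1) * f (inr xy.2)).
have cG : continuous G.
  apply: sum_cont => -[x y] f.
  apply: (@continuous_comp _ _ _ (fun f : E => f (inl x) * f (inr y)) (phi x y)).
    exact: (@continuousM _ E (fun f => f (inl x)) (fun f => f (inr y)) f
      (ev_cont _ _) (ev_cont _ _)).
  exact: cphi.
have K0 : K !=set0 by exists (join qX0 qY0); exact: joinK.
have [f fK fmin] := compact_EVT_min K0 cK (continuous_subspaceT cG).
have [[fB f1] f2] := set_mem fK.
have f_ge0 i : 0 <= f i by have /= := fB i; rewrite in_itv/= => /andP[].
exists (fun x => f (inl x)), (fun y => f (inr y)); split; [by split|by split|].
move=> qX' qY' qX'd qY'd; apply: (fmin (join qX' qY')); apply/mem_set.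
exact: joinK.
Qed.

End Existence.

(** * Optimal product distributions and their stationarity *)

Section Minimizers.
Set Implicit Arguments.
Unset Strict Implicit.
Context {R : realType}.
Implicit Type T X Y : finType.

Lemma le_powR_neg (e x y : R) : e <= 0 -> 0 < x -> x <= y -> y `^ e <= x `^ e.
Proof.
move=> e0 x0 xy; have y0 := lt_le_trans x0 xy.
rewrite -[e]opprK (powRN x) (powRN y) lef_pV2 ?posrE ?powR_gt0//.
by rewrite ge0_ler_powR ?oppr_ge0 ?nnegrE ?(ltW x0) ?(ltW y0).
Qed.

(** Combines [1 + v < expR v] at [v = e * ln u] with [ln u <= u - 1]. Strictness is what later
    forces uniqueness of a minimizer. *)
Lemma bernoulli_neg (e u : R) : e < 0 -> 0 < u -> u != 1 -> 1 + e * (u - 1) < u `^ e.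
Proof.
move=> e0 u0 u1; have lu : e * ln u != 0 by rewrite mulf_neq0 ?(lt_eqF e0) ?ln_eq0.
rewrite /powR gt_eqF//; apply: le_lt_trans (expR_gt1Dx lu).
by rewrite lerD2l ler_nM2l// ln_le_subr1.
Qed.

Lemma uniform_dist {T} : T -> is_dist (fun _ : T => #|T|%:R^-1 : R).
Proof.
move=> t; split=> [_|]; first by rewrite invr_ge0.
rewrite sumr_const -[LHS]mulr_natr mulVf// pnatr_eq0 -lt0n.
by apply/card_gt0P; exists t.
Qed.

Section Joint.
Context {X Y : finType} (a : R) (p : X * Y -> R).
Hypothesis pd : is_dist p.

Let prod (qX : X -> R) (qY : Y -> R) (xy : X * Y) : R := qX xy.1 * qY xy.2.

(** The uniform pair has a positive Hellinger sum, hence so does the maximizer, and its logarithm is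
    meaningful. *)
Lemma exists_max_hellinger : a < 1 -> exists qX qY,
  [/\ is_dist qX, is_dist qY, 0 < \sum_t hellinger a p (prod qX qY) t &
   forall qX' qY', is_dist qX' -> is_dist qY' ->
     \sum_t hellinger a p (prod qX' qY') t <= \sum_t hellinger a p (prod qX qY) t].
Proof.
move=> a1; have [[x y] pxy] := dist_supp pd.
have Xd := uniform_dist x; have Yd := uniform_dist y.
pose phi x y (u : R) := - (if 0 < p (x, y) then p (x, y) `^ a * `|u| `^ (1 - a) else 0).
have cphi x0 y0 : continuous (phi x0 y0).
  rewrite /phi; case: (0 < p _) => u; last by apply: cvgN; exact: cvg_cst.
  apply: cvgN; apply: (cvgM (cvg_cst _)).
  by apply: continuous_powR_norm; rewrite subr_gt0.
have phiE qX qY : is_dist qX -> is_dist qY ->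
    \sum_xy phi xy.1 xy.2 (qX xy.1 * qY xy.2) = - \sum_t hellinger a p (prod qX qY) t.
  move=> qXd qYd; rewrite -sumrN; apply: eq_bigr => -[x1 y1] _.
  by rewrite /phi /hellinger/= ger0_norm// mulr_ge0 ?qXd.1 ?qYd.1.
have [qX [qY [qXd qYd qmin]]] := exists_min_dist_prod cphi Xd Yd.
have qmax qX' qY' : is_dist qX' -> is_dist qY' ->
     \sum_t hellinger a p (prod qX' qY') t <= \sum_t hellinger a p (prod qX qY) t.
  by move=> qXd' qYd'; have := qmin _ _ qXd' qYd'; rewrite !phiE// lerN2.
exists qX, qY; split => //; apply: lt_le_trans (qmax _ _ Xd Yd).
apply: (@sum_gt0 _ _ _ (x, y)) => [t|]; first exact: hellinger_ge0.
apply: hellinger_gt0 => //; rewrite /prod mulr_gt0 ?invr_gt0 ?ltr0n//.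
  by apply/card_gt0P; exists x.
by apply/card_gt0P; exists y.
Qed.

(* Truncating each factor [u ^ (1 - a)] at a level [delta xy] that already makes
   its term exceed the value at the uniform distributions turns the objective
   into a continuous one without changing its minimum. *)
Lemma exists_min_hellinger : 1 < a -> exists qX qY,
  [/\ is_dist qX, is_dist qY, forall t, 0 < p t -> 0 < prod qX qY t &
   forall qX' qY', is_dist qX' -> is_dist qY' -> (forall t, 0 < p t -> 0 < prod qX' qY' t) ->
     \sum_t hellinger a p (prod qX qY) t <= \sum_t hellinger a p (prod qX' qY') t].
Proof.
move=> a1; have [[x y] pxy] := dist_supp pd.
have Xd := uniform_dist x; have Yd := uniform_dist y.
have Upos t : 0 < p t -> 0 < prod (fun _ : X => #|X|%:R^-1) (fun _ : Y => #|Y|%:R^-1) t.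
  move=> _; rewrite /prod mulr_gt0 ?invr_gt0 ?ltr0n//; apply/card_gt0P; first by exists x.
  by exists y.
set s0 := \sum_t hellinger a p (prod (fun _ : X => #|X|%:R^-1) (fun _ : Y => #|Y|%:R^-1)) t.
have s0_gt0 : 0 < s0.
  apply: (@sum_gt0 _ _ _ (x, y)) => [t|]; first exact: hellinger_ge0.
  by apply: hellinger_gt0 => //; exact: Upos.
(* At this level the term equals [2 * s0]; the factor 2 makes it exceed [s0] strictly. *)
pose delta t := (2 * s0 / p t `^ a) `^ (1 - a)^-1.
have delta0 t : 0 < p t -> 0 < delta t.
  by move=> pt; rewrite powR_gt0// divr_gt0 ?mulr_gt0// powR_gt0.
pose phi x y (u : R) :=
  if 0 < p (x, y) then p (x, y) `^ a * Num.max u (delta (x, y)) `^ (1 - a) else 0.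
have phi0 x1 y1 u : 0 <= phi x1 y1 u.
  by rewrite /phi; case: ifPn => // _; rewrite mulr_ge0 ?powR_ge0.
have cphi x1 y1 : continuous (phi x1 y1).
  have := delta0 (x1, y1); rewrite /phi; case: (0 < p _) => [/(_ isT) d0|_] u; last exact: cvg_cst.
  by apply: (cvgM (cvg_cst _)); exact: continuous_powR_max.
have phi_le qX qY : (forall t, 0 < p t -> 0 < prod qX qY t) ->
    \sum_xy phi xy.1 xy.2 (qX xy.1 * qY xy.2) <= \sum_t hellinger a p (prod qX qY) t.
  move=> pq; apply: ler_sum => -[x1 y1] _; rewrite /phi /hellinger/=.
  case: ifPn => // /[dup] /pq q0 p0; rewrite ler_pM2l ?powR_gt0//.
  by rewrite le_powR_neg ?le_max ?lexx//; lra.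
have [qX [qY [qXd qYd qmin]]] := exists_min_dist_prod cphi Xd Yd.
have q_gt t : 0 < p t -> delta t < qX t.1 * qY t.2.
  case: t => x1 y1 pt; rewrite ltNge; apply/negP => qd.
  have := le_trans (qmin _ _ Xd Yd) (phi_le _ _ Upos); rewrite -/s0 leNgt => /negP; apply.
  have /lt_le_trans : s0 < phi x1 y1 (qX x1 * qY y1).
    rewrite /phi pt max_r// -powRrM mulVf ?subr_eq0 ?lt_eqF//.
    rewrite powRr1 ?divr_ge0 ?mulr_ge0 ?powR_ge0 ?ltW//.
    by rewrite mulrC divfK ?gt_eqF ?powR_gt0//; lra.
  apply; rewrite (bigD1 (x1, y1))//= lerDl; apply: sumr_ge0 => t _; exact: phi0.
exists qX, qY; split => // [t pt|qX' qY' qXd' qYd' pq'].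
  by apply: lt_trans (delta0 _ pt) _; exact: q_gt.
apply: le_trans (phi_le _ _ pq'); apply: le_trans (qmin _ _ qXd' qYd').
rewrite le_eqVlt; apply/orP; left; apply/eqP; apply: eq_bigr => -[x1 y1] _.
by rewrite /phi /hellinger/=; case: ifPn => // /q_gt/= /ltW qd; rewrite max_l.
Qed.

End Joint.

(** Stationarity without derivatives: the minimizer is shown to be [q0], proportional to the power
    [a^-1] of [c], for which the claim is a computation. *)
Lemma weighted_powR_minimizer {T} (a : R) (c q : T -> R) t0 : 1 < a -> is_dist q ->
  (forall t, 0 <= c t) -> 0 < c t0 -> (forall t, 0 < c t -> 0 < q t) ->
  (forall q', is_dist q' -> (forall t, 0 < c t -> 0 < q' t) ->
    \sum_t c t * q t `^ (1 - a) <= \sum_t c t * q' t `^ (1 - a)) ->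
  forall t, c t * q t `^ (1 - a) = q t * \sum_t c t * q t `^ (1 - a).
Proof.
move=> a1 qd c0 ct0 cq qmin; set f := \sum_t _ in qmin *.
have a0 : 0 < a by lra.
pose w t := c t `^ a^-1; pose W := \sum_t w t.
have w0 t : 0 <= w t by exact: powR_ge0.
have W0 : 0 < W by apply: (@sum_gt0 _ _ _ t0) => //; exact: powR_gt0.
pose q0 t := w t / W.
have q0d : is_dist q0.
  by split=> [t|]; [rewrite divr_ge0// ltW|rewrite -mulr_suml divff ?gt_eqF].
have q0_gt0 t : 0 < c t -> 0 < q0 t by move=> ct; rewrite divr_gt0 ?powR_gt0.
have cE t : c t * q0 t `^ (1 - a) = q0 t * W `^ a.
  have [ct|] := ltP 0 (c t); last first.
    move=> ct; have {}ct : c t = 0 by apply/eqP; rewrite eq_le ct c0.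
    by rewrite ct /q0 /w ct powR0 ?mul0r// invr_neq0 ?gt_eqF.
  have wt : 0 < w t by exact: powR_gt0.
  have -> : c t = w t `^ a by rewrite -powRrM mulVf ?gt_eqF// powRr1.
  rewrite /q0 powRM ?invr_ge0 ?ltW// mulrA -powRD ?(gt_eqF wt) ?implybT//.
  rewrite addrC subrK powRr1 ?ltW// -mulrA; congr (_ * _).
  rewrite -powR_inv1 ?ltW// -powRrM -powRD ?(gt_eqF W0) ?implybT//; congr (_ `^ _); ring.
have fW : f <= W `^ a.
  apply: le_trans (qmin _ q0d q0_gt0) _.
  by rewrite (eq_bigr _ (fun t _ => cE t)) -mulr_suml q0d.2 mul1r.
have Wa0 : 0 < W `^ a by exact: powR_gt0.
(* Excess of a normalised term over its tangent at [q0]. It is nonnegative by Bernoulli and vanishes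
   only if [q t = q0 t], also where [c t = 0]. *)
pose h t := c t * q t `^ (1 - a) / W `^ a - (q0 t + (1 - a) * (q t - q0 t)).
have hE t : 0 < c t ->
    h t = q0 t * ((q t / q0 t) `^ (1 - a) - (1 + (1 - a) * (q t / q0 t - 1))).
  move=> ct; have [q0t qt] := (q0_gt0 _ ct, cq _ ct).
  rewrite /h.
  have -> : c t * q t `^ (1 - a) / W `^ a = q0 t * (q t / q0 t) `^ (1 - a).
    have u0 : 0 <= q t / q0 t by exact: divr_ge0 (ltW qt) (ltW q0t).
    rewrite -{1}(divfK (lt0r_neq0 q0t) (q t)) (@powRM _ _ _ _ u0 (ltW q0t)).
    by rewrite mulrCA cE; field; rewrite gt_eqF.
  by field; rewrite gt_eqF.
have h0 t : 0 <= h t /\ (h t = 0 -> q t = q0 t).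
  have [ct|] := ltP 0 (c t); last first.
    move=> ct; have {}ct : c t = 0 by apply/eqP; rewrite eq_le ct c0.
    have q0t : q0 t = 0 by rewrite /q0 /w ct powR0 ?mul0r// invr_neq0 ?gt_eqF.
    have -> : h t = (a - 1) * q t by rewrite /h ct q0t; ring.
    rewrite mulr_ge0 ?qd.1 ?subr_ge0 ?ltW// q0t; split => // /eqP.
    by rewrite mulf_eq0 subr_eq0 gt_eqF// => /eqP.
  have [q0t qt] := (q0_gt0 _ ct, cq _ ct); rewrite hE//.
  have [/divr1_eq -> |u1] := eqVneq (q t / q0 t) 1.
    by rewrite divff ?gt_eqF// powR1 subrr mulr0 addr0 subrr mulr0.
  have : 0 < (q t / q0 t) `^ (1 - a) - (1 + (1 - a) * (q t / q0 t - 1)).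
    by rewrite subr_gt0; apply: bernoulli_neg => //; [rewrite subr_lt0|exact: divr_gt0].
  move=> g0; split; first by rewrite mulr_ge0 ?ltW.
  by move/eqP; rewrite mulf_eq0 !gt_eqF.
(* The linear parts cancel, both [q] and [q0] having mass 1, so the sum is [f / W ^ a - 1], at most
   0 by minimality. *)
have hs : \sum_t h t = 0.
  apply/eqP; rewrite eq_le sumr_ge0 ?andbT; last by move=> t _; exact: (h0 t).1.
  rewrite sumrB big_split/= -mulr_suml -mulr_sumr sumrB qd.2 q0d.2 subrr mulr0 addr0.
  by rewrite subr_le0 ler_pdivrMr// mul1r.
have qE t : q t = q0 t.
  by apply: (h0 t).2; apply: (psumr_eq0P _ hs) => // t' _; exact: (h0 t').1.
have fE : f = W `^ a.
  rewrite /f (eq_bigr (fun t => q0 t * W `^ a)) => [|t _]; last by rewrite qE cE.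
  by rewrite -mulr_suml q0d.2 mul1r.
by move=> t; rewrite fE qE cE.
Qed.

(** For fixed [qY] the Hellinger sum is a weighted power sum in [qX], with row sums as terms;
    stationarity makes these proportional to [qX]. *)
Lemma escort_margX {X Y} (a : R) (p : X * Y -> R) (qX : X -> R) (qY : Y -> R) :
  1 < a -> is_dist p -> is_dist qX -> is_dist qY ->
  (forall t, 0 < p t -> 0 < qX t.1 * qY t.2) ->
  (forall qX', is_dist qX' -> (forall t, 0 < p t -> 0 < qX' t.1 * qY t.2) ->
    \sum_t hellinger a p (fun xy => qX xy.1 * qY xy.2) t <=
    \sum_t hellinger a p (fun xy => qX' xy.1 * qY xy.2) t) ->
  forall x, margX (escort a p (fun xy => qX xy.1 * qY xy.2)) x = qX x.
Proof.
move=> a1 pd qXd qYd pq qmin.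
pose c := margX (hellinger a p (fun xy => qY xy.2)).
have hE q x : is_dist q ->
    \sum_y hellinger a p (fun xy => q xy.1 * qY xy.2) (x, y) = c x * q x `^ (1 - a).
  move=> qd; rewrite /c /margX mulr_suml; apply: eq_bigr => y _.
  rewrite /hellinger/=; case: ifPn => _; rewrite ?mul0r//.
  by rewrite powRM ?qd.1 ?qYd.1// mulrCA mulrC.
have SE q : is_dist q -> \sum_t hellinger a p (fun xy => q xy.1 * qY xy.2) t =
    \sum_x c x * q x `^ (1 - a).
  move=> qd; rewrite -(eq_bigr _ (fun x _ => hE q x qd)) pair_big.
  by apply: eq_bigr => -[].
have pos_r (u v : R) : 0 <= v -> 0 < u * v -> 0 < v.
  by move=> v0; rewrite lt_neqAle => /andP[/eqP uv _]; rewrite lt_neqAle v0 andbT;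
    apply/eqP => v1; apply: uv; rewrite -v1 mulr0.
have qY_gt0 t : 0 < p t -> 0 < qY t.2 by move=> /pq; apply: pos_r; exact: qYd.1.
have qX_gt0 t : 0 < p t -> 0 < qX t.1.
  by move=> /pq; rewrite mulrC; apply: pos_r; exact: qXd.1.
have c_ge0 x : 0 <= c x by apply: sumr_ge0 => y _; exact: hellinger_ge0.
have c_gt0 t : 0 < p t -> 0 < c t.1.
  case: t => x y pt; apply: (@sum_gt0 _ _ _ y) => [y'|]; first exact: hellinger_ge0.
  by apply: hellinger_gt0 => //; exact: (qY_gt0 (x, y)).
have c_ex x : 0 < c x -> exists y, 0 < p (x, y).
  move=> cx; apply: contrapT => /forallNP pN; move: cx; rewrite /c /margX big1 ?ltxx// => y _.
  by rewrite /hellinger ifF//; exact/negP/pN.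
have [t0 pt0] := dist_supp pd.
have cq x : 0 < c x -> 0 < qX x by move=> /c_ex[y /qX_gt0].
have stat := weighted_powR_minimizer a1 qXd c_ge0 (c_gt0 _ pt0) cq.
have S_gt0 : 0 < \sum_t hellinger a p (fun xy => qX xy.1 * qY xy.2) t.
  apply: (@sum_gt0 _ _ _ t0) => [t|]; first exact: hellinger_ge0.
  by apply: hellinger_gt0 => //; exact: pq.
move=> x; rewrite /margX /escort -mulr_suml hE// stat; last first.
  move=> q' qd' cq'; rewrite -!SE//; apply: qmin => // t pt.
  by rewrite mulr_gt0 ?qY_gt0 ?cq' ?c_gt0.
by rewrite -SE// mulfK ?gt_eqF.
Qed.

Lemma sum_swap {X Y} (F : X * Y -> R) : \sum_yx F (yx.2, yx.1) = \sum_xy F xy.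
Proof.
rewrite -(pair_big xpredT xpredT (fun y x => F (x, y)))/= exchange_big/= pair_big.
by apply: eq_bigr => -[].
Qed.

Lemma escort_margY {X Y} (a : R) (p : X * Y -> R) (qX : X -> R) (qY : Y -> R) :
  1 < a -> is_dist p -> is_dist qX -> is_dist qY ->
  (forall t, 0 < p t -> 0 < qX t.1 * qY t.2) ->
  (forall qY', is_dist qY' -> (forall t, 0 < p t -> 0 < qX t.1 * qY' t.2) ->
    \sum_t hellinger a p (fun xy => qX xy.1 * qY xy.2) t <=
    \sum_t hellinger a p (fun xy => qX xy.1 * qY' xy.2) t) ->
  forall y, \sum_x escort a p (fun xy => qX xy.1 * qY xy.2) (x, y) = qY y.
Proof.
move=> a1 pd qXd qYd pq qmin y.
(* Transposing the joint distribution reduces the claim to the first marginal. *)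
pose p' (yx : Y * X) := p (yx.2, yx.1).
have pd' : is_dist p' by split=> [t|]; [exact: pd.1|rewrite /p' sum_swap pd.2].
have hE q t : hellinger a p' (fun yx => q yx.1 * qX yx.2) t =
    hellinger a p (fun xy => qX xy.1 * q xy.2) (t.2, t.1).
  by rewrite /hellinger /p'/= [q _ * _]mulrC.
have SE q : \sum_t hellinger a p' (fun yx => q yx.1 * qX yx.2) t =
    \sum_t hellinger a p (fun xy => qX xy.1 * q xy.2) t.
  by rewrite -(sum_swap (hellinger a p _)); apply: eq_bigr => t _; rewrite hE.
rewrite -[RHS](@escort_margX _ _ a p' qY qX)//.
- by apply: eq_bigr => x _; rewrite /escort SE hE.
- by move=> t /pq; rewrite mulrC.
- move=> qY' qYd' pq'; rewrite !SE; apply: qmin => // -[x1 y1] pt.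
  by rewrite mulrC; exact: (pq' (y1, x1)).
Qed.

End Minimizers.

(** * Bounds on the Lapidoth-Pfister information and their attainment *)

Section LapidothPfister.
Set Implicit Arguments.
Unset Strict Implicit.
Context {R : realType} {X Y : finType}.
Variables (a : R) (pX : X -> R) (pYX : X -> Y -> R).
Hypotheses (pXd : is_dist pX) (pYXd : forall x, is_dist (pYX x)).

Local Notation A := (a / (1 - a)).
Let p (xy : X * Y) : R := pX xy.1 * pYX xy.1 xy.2.

Let pd : is_dist p. Proof. exact: prod_dist. Qed.

Let pXpYX_gt0 xy : 0 < p xy -> 0 < pX xy.1 /\ 0 < pYX xy.1 xy.2.
Proof.
rewrite /p !lt_neqAle pXd.1 (pYXd _).1 !andbT => /andP[+ _].
by rewrite eq_sym mulf_eq0 negb_or ![0 == _]eq_sym => /andP[].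
Qed.

Lemma KL_chain_scaled (tq : X * Y -> R) : is_dist tq ->
  (A%:E * KL tq (fun xy => (margX tq xy.1 * pYX xy.1 xy.2)%R)
   + A%:E * KL (margX tq) pX = A%:E * KL tq p)%E.
Proof.
move=> td; rewrite -muleDr// ?KL_chain//.
- exact: pXd.1.
- by move=> x y; exact: (pYXd x).1.
(* Distributivity needs the sum not to be [+oo - oo]; divergences are never [-oo]. *)
- by rewrite /adde_def !(negPf (KL_ninfty _ _)) andbF.
Qed.

Lemma F_LP_chain (tq : X * Y -> R) (qY : Y -> R) : is_dist tq ->
  F_LP a pX pYX tq qY =
  (A%:E * KL tq p + KL tq (fun xy => (margX tq xy.1 * qY xy.2)%R))%E.
Proof. by move=> td; rewrite /F_LP addeAC KL_chain_scaled. Qed.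

Lemma Ft_LP_chain (tq : X * Y -> R) (r : Y -> X -> R) : is_dist tq ->
  Ft_LP a pX pYX tq r = (A%:E * KL tq p + Elog tq r)%E.
Proof. by move=> td; rewrite /Ft_LP addeAC KL_chain_scaled. Qed.

Lemma ILP_le (qX : X -> R) (qY : Y -> R) : is_dist qX -> is_dist qY ->
  (ILP a pX pYX <= renyi a p (fun xy => (qX xy.1 * qY xy.2)%R))%E.
Proof. by move=> qXd qYd; apply: ereal_inf_lbound; exists qX, qY. Qed.

Lemma le_ILP v : (forall qX qY, is_dist qX -> is_dist qY ->
    (v <= renyi a p (fun xy => (qX xy.1 * qY xy.2)%R))%E) ->
  (v <= ILP a pX pYX)%E.
Proof. by move=> vle; apply: le_ereal_inf_tmp => _ [qX [qY [qXd qYd ->]]]; exact: vle. Qed.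

(** The marginal of [tq] serves as [qX] in the infimum. *)
Lemma ILP_le_F_LP (tq : X * Y -> R) (qY : Y -> R) : 0 < a < 1 ->
  is_dist tq -> is_dist qY -> (ILP a pX pYX <= F_LP a pX pYX tq qY)%E.
Proof.
move=> a01 td qYd; rewrite F_LP_chain//; have md := margX_dist td.
apply: le_trans (ILP_le md qYd) _; apply: renyi_le => //; first by lra.
- exact: pd.1.
- by move=> xy; rewrite mulr_ge0 ?md.1 ?qYd.1.
Qed.

Lemma Ft_LP_le_ILP (tq : X * Y -> R) (r : Y -> X -> R) : 1 < a ->
  is_dist tq -> (forall y, is_dist (r y)) ->
  (Ft_LP a pX pYX tq r <= ILP a pX pYX)%E.
Proof.
move=> a1 td rd; apply: le_ILP => qX qY qXd qYd; rewrite Ft_LP_chain//.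
apply: le_trans (renyi_ge _ td pd.1 _ a1); [|by lra|]; last first.
  by move=> xy; rewrite mulr_ge0 ?qXd.1 ?qYd.1.
apply: leeD => //; apply: le_trans (Elog_le td qYd rd) _.
by apply: KL_margX_le => //; exact: qYd.1.
Qed.

(** * Maximization over the joint distribution for a fixed reverse channel *)

Section ReverseChannel.
Variable r : Y -> X -> R.
Hypotheses (a1 : 1 < a) (rd : forall y, is_dist (r y)).

Let a_gt0 : 0 < a. Proof. exact: lt_trans a1. Qed.
Let d_gt0 : 0 < 2 * a - 1.
Proof. by rewrite subr_gt0 (lt_trans a1)// ltr_pMl// ltr1n. Qed.
Let A_lt0 : A < 0. Proof. by rewrite pmulr_rlt0 ?invr_lt0 ?subr_lt0. Qed.
Let b := a / (2 * a - 1).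
(** [Z], [W] and [S] are the inner sum, the summand and the outer sum of [G_LP]. *)
Let Z x := \sum_y pYX x y * r y x `^ (1 - a^-1).
Let W x := pX x `^ b * Z x `^ b.
Let S := \sum_x W x.

Let b_gt0 : 0 < b. Proof. exact: divr_gt0. Qed.
Let e_gt0 : 0 < 1 - a^-1. Proof. by rewrite subr_gt0 invf_lt1. Qed.
Let Z_ge0 x : 0 <= Z x.
Proof. by apply: sumr_ge0 => y _; rewrite mulr_ge0 ?powR_ge0// (pYXd x).1. Qed.
Let W_ge0 x : 0 <= W x. Proof. by rewrite mulr_ge0 ?powR_ge0. Qed.
Let S_ge0 : 0 <= S. Proof. exact: sumr_ge0. Qed.

(* The maximizer over the joint distribution of the objective at fixed [r]. *)
Definition tilt (xy : X * Y) : R :=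
  W xy.1 / S * (pYX xy.1 xy.2 * r xy.2 xy.1 `^ (1 - a^-1) / Z xy.1).

Lemma margX_tilt x : margX tilt x = W x / S.
Proof.
rewrite /margX /tilt/= -mulr_sumr -mulr_suml -/(Z x).
(* Division by [Z x = 0] is harmless: [W x] then vanishes too, because [0 < b]. *)
have [Z0|Z0] := eqVneq (Z x) 0; last by rewrite divff// mulr1.
by rewrite /W Z0 powR0 ?gt_eqF// mulr0 !mul0r.
Qed.

Lemma tilt_dist : S != 0 -> is_dist tilt.
Proof.
move=> S0; split.
  by move=> xy; rewrite mulr_ge0 ?divr_ge0 ?mulr_ge0 ?powR_ge0 ?(pYXd _).1.
rewrite -(pair_big xpredT xpredT (fun x y => tilt (x, y)))/=.
rewrite (eq_bigr (fun x => W x / S)) => [|x _]; last exact: margX_tilt.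
by rewrite -mulr_suml divff.
Qed.

Lemma tilt_supp xy : 0 < tilt xy -> 0 < p xy /\ 0 < r xy.2 xy.1.
Proof.
move=> t0; have {}t0 : tilt xy != 0 by rewrite gt_eqF.
move: t0; rewrite /tilt /W !mulf_eq0 !negb_or => /andP[/andP[/andP[+ _] _]].
rewrite powR_eq0 (gt_eqF b_gt0) andbT => pX0 /andP[/andP[pYX0 +] _].
rewrite powR_eq0 (gt_eqF e_gt0) andbT => r0.
split; first by rewrite /p mulr_gt0// lt_neqAle eq_sym ?pX0 ?pYX0 ?pXd.1 ?(pYXd _).1.
by rewrite lt_neqAle eq_sym r0 (rd _).1.
Qed.

Let Z_gt0 xy : 0 < p xy -> 0 < r xy.2 xy.1 -> 0 < Z xy.1.
Proof.
case: xy => x y /pXpYX_gt0[/= _ pYX0] r0; apply: (@sum_gt0 _ _ _ y) => [y'|].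
  by rewrite mulr_ge0 ?powR_ge0// (pYXd x).1.
by rewrite mulr_gt0 ?powR_gt0.
Qed.

Let W_gt0 xy : 0 < p xy -> 0 < r xy.2 xy.1 -> 0 < W xy.1.
Proof.
move=> p0 r0; have [pX0 _] := pXpYX_gt0 p0.
by rewrite mulr_gt0 ?powR_gt0 ?(Z_gt0 p0).
Qed.

Let S_gt0 xy : 0 < p xy -> 0 < r xy.2 xy.1 -> 0 < S.
Proof. by move=> p0 r0; apply: (@sum_gt0 _ _ _ xy.1) => //; exact: W_gt0. Qed.

Let tilt_gt0 xy : 0 < p xy -> 0 < r xy.2 xy.1 -> 0 < tilt xy.
Proof.
move=> p0 r0; have [_ pYX0] := pXpYX_gt0 p0.
apply: mulr_gt0; apply: divr_gt0; [exact: W_gt0|exact: S_gt0 p0 r0| |exact: Z_gt0].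
by rewrite mulr_gt0 ?powR_gt0.
Qed.

(* The objective falls short of [G_LP r] by exactly
   a/(a-1) D(tq || tilt) + D(tq_X || tilt_X). *)
Lemma Ft_LP_tilt (tq : X * Y -> R) : is_dist tq ->
  (forall xy, 0 < tq xy -> 0 < p xy) -> (forall xy, 0 < tq xy -> 0 < r xy.2 xy.1) ->
  Ft_LP a pX pYX tq r =
  ((2 * a - 1) / (a - 1) * ln S
   - A * (\sum_(xy | 0 < tq xy) tq xy * (ln (tilt xy) - ln (tq xy)))
   + \sum_(xy | 0 < tq xy) tq xy * (ln (W xy.1 / S) - ln (margX tq xy.1)))%:E.
Proof.
move=> td tp tr; rewrite Ft_LP_chain// KL_fin// Elog_fin// -EFinM -EFinD; congr EFin.
(* The constant is written as a mean under [tq], so that the identity can be checked pointwise. *)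
rewrite -[X in X - _ + _](dist_mean_const _ td) !mulr_sumr -sumrB -!big_split/=.
apply: eq_bigr => xy t0; have [p0 r0] := (tp _ t0, tr _ t0).
have [pX0 pYX0] := pXpYX_gt0 p0.
have [[Z0 W0] S0] := (Z_gt0 p0 r0, W_gt0 p0 r0, S_gt0 p0 r0).
have lnW : ln (W xy.1) = b * (ln (pX xy.1) + ln (Z xy.1)).
  by rewrite lnM ?posrE ?powR_gt0// !ln_powR mulrDr.
have lnWS : ln (W xy.1 / S) = ln (W xy.1) - ln S by rewrite ln_div ?posrE.
have -> : ln (tilt xy) = ln (W xy.1 / S) +
    (ln (pYX xy.1 xy.2) + (1 - a^-1) * ln (r xy.2 xy.1) - ln (Z xy.1)).
  have pr0 : 0 < pYX xy.1 xy.2 * r xy.2 xy.1 `^ (1 - a^-1) by rewrite mulr_gt0 ?powR_gt0.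
  rewrite /tilt lnM ?posrE; [congr (_ + _)|exact: divr_gt0|exact: divr_gt0].
  by rewrite ln_div ?posrE// lnM ?posrE ?powR_gt0// ln_powR.
rewrite lnWS lnW /p lnM ?posrE// /b; field.
by rewrite !subr_eq0 (gt_eqF a_gt0) (gt_eqF a1) (lt_eqF a1) -subr_eq0 (gt_eqF d_gt0).
Qed.

Lemma Ft_LP_le_G (tq : X * Y -> R) : is_dist tq ->
  (Ft_LP a pX pYX tq r <= G_LP a pX pYX r)%E.
Proof.
move=> td.
have [tp|[xy [t0 p0]]] := KL_cases tq pd.1; last first.
  by rewrite Ft_LP_chain// (KL_infty t0 p0) lt0_muley ?lte_fin// addNye leNye.
have [tr|rN] := Elog_cases tq (fun y x => (rd y).1 x); last first.
  by rewrite Ft_LP_chain// rN addeNy leNye.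
have [xy0 t0] := dist_supp td.
have S0 : 0 < S := S_gt0 (tp _ t0) (tr _ t0).
have tiltd := tilt_dist (lt0r_neq0 S0).
rewrite Ft_LP_tilt// /G_LP -/b -/S gt_eqF// lee_fin -addrA gerDl.
have g1 : \sum_(xy | 0 < tq xy) tq xy * (ln (tilt xy) - ln (tq xy)) <= 0.
  rewrite -[leRHS](@ln1 R) -tiltd.2; apply: gibbs => //; first exact: tiltd.1.
  by move=> xy txy; rewrite tilt_gt0 ?tp ?tr.
have g2 : \sum_(xy | 0 < tq xy) tq xy * (ln (W xy.1 / S) - ln (margX tq xy.1)) <= 0.
  apply: (@gibbs_margX _ _ _ _ (fun x => W x / S)) => //.
    by rewrite -(funext margX_tilt); exact: margX_dist.
  by move=> xy txy; rewrite divr_gt0 ?W_gt0 ?tp ?tr.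
by rewrite -[leRHS]addr0 lerD// oppr_le0 nmulr_rge0.
Qed.

Lemma Ft_LP_tilt_eq_G : S != 0 -> Ft_LP a pX pYX tilt r = G_LP a pX pYX r.
Proof.
move=> S0; have td := tilt_dist S0.
rewrite Ft_LP_tilt//; [|by move=> xy /tilt_supp[]..].
rewrite /G_LP -/b -/S (negPf S0) !big1 ?mulr0 ?subr0 ?addr0// => xy _.
  by rewrite margX_tilt subrr mulr0.
by rewrite subrr mulr0.
Qed.

(** Unless it is [-oo], [G_LP] is the value of [Ft_LP] at [tilt], so weak duality applies. *)
Lemma G_LP_le_ILP : (G_LP a pX pYX r <= ILP a pX pYX)%E.
Proof.
have [S0|S0] := eqVneq S 0; first by rewrite /G_LP -/b -/S S0 eqxx leNye.
by rewrite -Ft_LP_tilt_eq_G// Ft_LP_le_ILP//; exact: tilt_dist.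
Qed.

End ReverseChannel.

Lemma ILP_is_min_F_LP : 0 < a < 1 ->
  is_min (fun qq : (X * Y -> R) * (Y -> R) => is_dist qq.1 /\ is_dist qq.2)
         (fun qq => F_LP a pX pYX qq.1 qq.2) (ILP a pX pYX).
Proof.
move=> /[dup] a01 /andP[a0 a1]; split; last first.
  by move=> [tq qY] /= [td qYd]; exact: ILP_le_F_LP.
have [qX [qY [qXd qYd S0 qmax]]] := exists_max_hellinger pd a1.
set q := fun xy : X * Y => qX xy.1 * qY xy.2.
have q0 xy : 0 <= q xy by rewrite mulr_ge0 ?qXd.1 ?qYd.1.
have td : is_dist (escort a p q) by exact: escort_dist.
exists (escort a p q, qY); first by [].
apply/eqP; rewrite eq_le ILP_le_F_LP// andbT F_LP_chain//=.
apply: le_trans (leeD2l _ (KL_margX_le td qXd qYd.1)) _.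
rewrite escort_KL//; last by lra.
apply: le_ILP => qX' qY' qXd' qYd'.
pose q' (xy : X * Y) := qX' xy.1 * qY' xy.2; rewrite -/q'.
(* A zero Hellinger sum means an infinite divergence; otherwise the negative factor [(a - 1)^-1]
   turns the maximal sum into the minimal divergence. *)
have [S0'|S0'] := eqVneq (\sum_t hellinger a p q' t) 0.
  by rewrite /renyi a1 -/(hellinger a p q') [X in if X then _ else _](introT eqP S0') leey.
rewrite renyi_fin//; last by rewrite leNgt a1.
rewrite lee_fin ler_nM2l ?invr_lt0 ?subr_lt0// ler_ln ?posrE//; first exact: qmax.
by rewrite lt_neqAle eq_sym S0' sumr_ge0// => t _; exact: hellinger_ge0.
Qed.

Lemma ILP_attained : 1 < a -> exists tq r,
  [/\ is_dist tq, forall y, is_dist (r y) & Ft_LP a pX pYX tq r = ILP a pX pYX].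
Proof.
move=> a1.
have [qX [qY [qXd qYd pq qmin]]] := exists_min_hellinger pd a1.
pose q (xy : X * Y) := qX xy.1 * qY xy.2; rewrite -/q in pq.
have q0 xy : 0 <= q xy by rewrite mulr_ge0 ?qXd.1 ?qYd.1.
have S0 : 0 < \sum_t hellinger a p q t.
  have [t0 p0] := dist_supp pd.
  apply: (@sum_gt0 _ _ _ t0) => [t|]; first exact: hellinger_ge0.
  by apply: hellinger_gt0 => //; exact: pq.
pose tq := escort a p q.
have td : is_dist tq by exact: escort_dist.
have tX x : margX tq x = qX x.
  by apply: escort_margX => // qX' qXd' pq'; exact: qmin.
have tY y : \sum_x tq (x, y) = qY y.
  by apply: escort_margY => // qY' qYd' pq'; exact: qmin.
(* The reverse conditional of [tq]. Where [qY y = 0], [tq] has no mass and [pX] merely fills in a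
   distribution. *)
pose r y x := if 0 < qY y then tq (x, y) / qY y else pX x.
have rd y : is_dist (r y).
  rewrite /r; case: (ltP 0 (qY y)) => // qy; split=> [x|].
    by rewrite divr_ge0 ?td.1// ltW.
  by rewrite -mulr_suml tY divff// gt_eqF.
have tqX xy : 0 < tq xy -> 0 < qX xy.1 by rewrite -tX; exact: margX_gt0.
have tqY xy : 0 < tq xy -> 0 < qY xy.2.
  case: xy => x y /lt_le_trans; apply; rewrite -tY (bigD1 x)//= lerDl.
  by apply: sumr_ge0 => x' _; exact: td.1.
(* As [qX] and [qY] are the marginals of [tq], on its support [r / tq_X = tq / (qX * qY)]. *)
have Elog_KL : Elog tq r = KL tq q.
  rewrite Elog_fin//; last first.
    by move=> [x y] t0; rewrite /r (tqY (x, y))// divr_gt0// (tqY (x, y)).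
  rewrite KL_fin => [|xy t0]; last by rewrite /q mulr_gt0 ?tqX ?tqY.
  congr EFin; apply: eq_bigr => -[x y] t0.
  have [qx qy] := (tqX _ t0, tqY _ t0).
  by rewrite /r/= qy tX /q/= ln_div ?posrE// lnM ?posrE//; ring.
exists tq, r; split => //; apply/eqP; rewrite eq_le Ft_LP_le_ILP//=.
rewrite Ft_LP_chain// Elog_KL escort_KL//; last by rewrite gt_eqF.
rewrite -renyi_fin//; last by rewrite ltNge (ltW a1).
exact: ILP_le.
Qed.

End LapidothPfister.

Theorem theorem3 (R : realType) (X Y : finType) (a : R)
  (pX : X -> R) (pYX : X -> Y -> R) :
  0 < a -> a != 1 ->
  is_dist pX -> (forall x : X, is_dist (pYX x)) ->
  (a < 1 ->
     is_min (fun qq : (X * Y -> R) * (Y -> R) => is_dist qq.1 /\ is_dist qq.2)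
            (fun qq => F_LP a pX pYX qq.1 qq.2)
            (ILP a pX pYX)) /\
  (1 < a ->
     is_max (fun qr : (X * Y -> R) * (Y -> X -> R) =>
               is_dist qr.1 /\ forall y : Y, is_dist (qr.2 y))
            (fun qr => Ft_LP a pX pYX qr.1 qr.2)
            (ILP a pX pYX)
     /\
     is_max (fun r : Y -> X -> R => forall y : Y, is_dist (r y))
            (fun r => G_LP a pX pYX r)
            (ILP a pX pYX)).
Proof.
move=> a0 _ pXd pYXd; split=> [a1|a1].
  by apply: ILP_is_min_F_LP => //; rewrite a0.
have [tq [r [td rd tqE]]] := ILP_attained pXd pYXd a1.
split; split.
- by exists (tq, r).
- by move=> [tq' r'] /= [td' rd']; exact: Ft_LP_le_ILP.
(* The reverse channel optimal for [Ft_LP] is optimal here, as [G_LP] dominates [Ft_LP] at every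
   [tq]. *)
- exists r => //; apply/eqP; rewrite eq_le G_LP_le_ILP//= -tqE.
  exact: Ft_LP_le_G.
- by move=> r' rd'; exact: G_LP_le_ILP.
Qed.
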